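(* Let $I$ be a finite index set, equipped with a fixed total order $<$, and let $(X_i)_{i\in I}$ be positively associated random variables on a common probability space, each taking values in $\{0,1\}$. Put $X=\sum_{i\in I}X_i$. Then for all $t>0$ $$ \mathbb{P}(X=0)\le e^{-t|I|}\left(\prod_{i\in I}\mathbb{E}\left[e^{t(1-X_i)}\right]+t^2e^{t|I|}\sum_{i<j}\mathrm{Cov}(X_i,X_j)\right), $$ where the sum runs over all pairs $i,j\in I$ with $i<j$. If, in addition, the $X_i$ are identically distributed with $\mathbb{P}(X_i=1)=p=1-\mathbb{P}(X_i=0)$ for all $i\in I$, then for all $t>0$ $$ \mathbb{P}(X=0)\le e^{-t|I|}\left(p+(1-p)e^{t}\right)^{|I|}+t^2\sum_{i<j}\mathrm{Cov}(X_i,X_j), $$ and, when $p<1$, the right-hand side of this last inequality equals $$ (1-p)^{|I|}\left(1+e^{-t}\frac{p}{1-p}\right)^{|I|}+t^2\sum_{i<j}\mathrm{Cov}(X_i,X_j). $$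
   Context: A finite family $(X_i)_{i\in I}$ of $\{0,1\}$-valued random variables is called positively associated (or associated) if for all coordinatewise increasing (that is, non-decreasing in each coordinate) functions $f,g:\mathbb{R}^{|I|}\to\mathbb{R}$ one has $\mathrm{Cov}\big(f(X_i,\,i\in I),\,g(X_i,\,i\in I)\big)\ge 0$. Here $\mathrm{Cov}(U,V)=\mathbb{E}[UV]-\mathbb{E}[U]\mathbb{E}[V]$, and $|I|$ denotes the cardinality of $I$. *)

(* Defs.v *)
From HB Require Import structures.
From mathcomp Require Import all_boot all_order all_algebra.
From mathcomp Require Import all_classical all_reals all_analysis.
Set Implicit Arguments.
Unset Strict Implicit.
Unset Printing Implicit Defensive.
Import Order.TTheory GRing.Theory Num.Theory.
Local Open Scope ring_scope.

Definition coordwise_increasing (R : realType) (I : finType)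
    (f : (I -> R) -> R) : Prop :=
  forall x y : I -> R, (forall i, x i <= y i) -> f x <= f y.

(* For {0,1}-valued measurable X, the compositions f(X) and g(X) take finitely
   many values and are measurable and bounded for every f and g; hence no
   measurability or integrability condition on the test functions. *)
Definition positively_associated (d : measure_display) (T : measurableType d)
    (R : realType) (P : probability T R) (I : finType)
    (X : I -> T -> R) : Prop :=
  forall f g : (I -> R) -> R,
    coordwise_increasing f -> coordwise_increasing g ->
    (0 <= covariance P (fun w => f (fun i => X i w))
                       (fun w => g (fun i => X i w)))%E.

(* Main.v *)
Require Import Defs.
From HB Require Import structures.
From mathcomp Require Import all_boot all_order all_algebra.
From mathcomp Require Import all_classical all_reals all_analysis.
From mathcomp Require Import ring lra.
Set Implicit Arguments.
Unset Strict Implicit.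
Unset Printing Implicit Defensive.
Import Order.TTheory GRing.Theory Num.Theory.
Local Open Scope classical_set_scope.
Local Open Scope ring_scope.

(** Since E[exp (t (1 - X_i))] = exp t * (1 - c E X_i) with
    c = 1 - exp (- t), the claim amounts to
      P(X = 0) <= \prod_i (1 - c E X_i) + t^2 \sum_(i < j) Cov(X_i, X_j).
    The left side is at most E[\prod_i (1 - c X_i)], because that product is
    nonnegative and equals 1 where all the X_i vanish.  What remains is a
    comparison of Newman's type between the mean of a product and the product
    of the means, lemma [newman], followed by c <= t.

    The comparison goes by peeling off one factor k.  The error made in
    replacing X_k by its mean is - c Cov(F, X_k), where F is the product of
    the other factors.  F is decreasing, which gives this error a sign but no
    size; however each partial derivative of F lies in [- c, 0], so
    c \sum_j X_j + F is increasing ([prod_lipschitz]), and association bounds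
    - Cov(F, X_k) by c \sum_j Cov(X_j, X_k).  These bounds are
    nonnegative and every factor has mean in [0, 1], so the errors add up to at
    most c^2 \sum_(i < j) Cov(X_i, X_j).

    Only the joint law of the X_i matters, and it is carried by the finite
    set of boolean configurations [{ffun I -> bool}].  The argument is hence
    run with finite weighted sums, and [expectation_success] and
    [covariance_success] carry it over to the probability space. *)

(** * Means and covariances under a finite weight *)

Definition mean (R : comPzRingType) (B : finType) (q F : B -> R) : R :=
  \sum_b q b * F b.

Definition cov (R : comPzRingType) (B : finType) (q F G : B -> R) : R :=
  mean q (fun b => F b * G b) - mean q F * mean q G.

Lemma mean_sum (R : comPzRingType) (B : finType) (q : B -> R) (J : Type)
    (s : seq J) (F : J -> B -> R) :
  mean q (fun b => \sum_(j <- s) F j b) = \sum_(j <- s) mean q (F j).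
Proof.
by rewrite /mean exchange_big /=; apply: eq_bigr => b _; rewrite mulr_sumr.
Qed.

Lemma meanZ (R : comPzRingType) (B : finType) (q : B -> R) (a : R)
    (F : B -> R) :
  mean q (fun b => a * F b) = a * mean q F.
Proof. by rewrite /mean mulr_sumr; apply: eq_bigr => b _; rewrite mulrCA. Qed.

Lemma meanD (R : comPzRingType) (B : finType) (q F G : B -> R) :
  mean q (fun b => F b + G b) = mean q F + mean q G.
Proof. by rewrite /mean -big_split; apply: eq_bigr => b _; rewrite mulrDr. Qed.

Lemma mean_le (R : numDomainType) (B : finType) (q F G : B -> R) :
  (forall b, 0 <= q b) -> (forall b, F b <= G b) -> mean q F <= mean q G.
Proof. by move=> q0 FG; apply: ler_sum => b _; rewrite ler_wpM2l. Qed.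

Lemma mean_cst (R : comPzRingType) (B : finType) (q : B -> R) (a : R) :
  \sum_b q b = 1 -> mean q (fun=> a) = a.
Proof. by move=> q1; rewrite /mean -mulr_suml q1 mul1r. Qed.

Lemma covDl (R : comPzRingType) (B : finType) (q F G H : B -> R) :
  cov q (fun b => F b + G b) H = cov q F H + cov q G H.
Proof.
rewrite /cov meanD.
under [in mean q (fun b => (F b + G b) * H b)]eq_fun do rewrite mulrDl.
by rewrite meanD; ring.
Qed.

Lemma cov_suml (R : comPzRingType) (B : finType) (q : B -> R) (J : Type)
    (s : seq J) (a : R) (F : J -> B -> R) (H : B -> R) :
  cov q (fun b => a * \sum_(j <- s) F j b) H = a * \sum_(j <- s) cov q (F j) H.
Proof.
rewrite /cov meanZ mean_sum sumrB mulrBr -mulr_suml mulrA; congr (_ - _).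
under eq_fun do rewrite -mulrA mulr_suml.
by rewrite meanZ mean_sum.
Qed.

Lemma covC (R : comPzRingType) (B : finType) (q F G : B -> R) :
  cov q F G = cov q G F.
Proof.
by rewrite /cov mulrC; congr (_ - _); congr mean; apply/funext => b; rewrite mulrC.
Qed.

(** * A comparison inequality for associated boolean variables *)

(** The partial derivatives of [\prod_j (1 - c * u j)] on the unit cube are at
    least [- c], being [- c] times a product of factors in [0, 1].  This is the
    monotonicity of [c * \sum_j u j + \prod_j (1 - c * u j)], written as a
    difference. *)
Lemma prod_lipschitz (R : realFieldType) (J : Type) (s : seq J) (c : R)
    (u v : J -> R) : 0 <= c <= 1 ->
  (forall j, 0 <= u j) -> (forall j, u j <= v j) -> (forall j, v j <= 1) ->
  \prod_(j <- s) (1 - c * u j) - \prod_(j <- s) (1 - c * v j) <=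
  c * \sum_(j <- s) (v j - u j).
Proof.
move=> /andP[c0 c1] u0 uv v1.
have fac (w : J -> R) (w0 : forall j, 0 <= w j) (w1 : forall j, w j <= 1) j :
    0 <= 1 - c * w j <= 1.
  by have := w0 j; have := w1 j => ? ?; apply/andP; split; nra.
have facu := fac u u0 (fun j => le_trans (uv j) (v1 j)).
have facv := fac v (fun j => le_trans (u0 j) (uv j)) v1.
elim: s => [|j s IH]; first by rewrite !big_nil subrr mulr0.
rewrite !big_cons.
set U := \prod_(i <- s) (1 - c * u i) in IH *.
set V := \prod_(i <- s) (1 - c * v i) in IH *.
set S := \sum_(i <- s) (v i - u i) in IH *.
have V0 : 0 <= V <= 1.
  apply/andP; split; last by apply: prodr_ile1 => i _; exact: facv.
  by apply: prodr_ge0 => i _; have /andP[] := facv i.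
have S0 : 0 <= S by apply: sumr_ge0 => i _; rewrite subr_ge0.
have /andP[a0 a1] := facu j; have /andP[V0' V1] := V0.
(* Change the tail from u to v first, then the head. *)
have -> : (1 - c * u j) * U - (1 - c * v j) * V =
  (1 - c * u j) * (U - V) + c * (v j - u j) * V by ring.
rewrite [leRHS]mulrDr [leRHS]addrC; apply: lerD; last first.
  by apply: ler_piMr => //; rewrite mulr_ge0// subr_ge0.
apply: (le_trans (ler_wpM2l a0 IH)).
by apply: ler_piMl => //; rewrite mulr_ge0.
Qed.

Definition associated_law (R : realFieldType) (I : finType)
    (q : {ffun I -> bool} -> R) : Prop :=
  forall F G : {ffun I -> bool} -> R,
    (forall b b' : {ffun I -> bool}, (forall i, b i -> b' i) -> F b <= F b') ->
    (forall b b' : {ffun I -> bool}, (forall i, b i -> b' i) -> G b <= G b') ->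
    0 <= cov q F G.

(** An upper bound for the defect of independence of decreasing functions by
    the covariances alone.  The list is taken increasing so that, when its
    head [k] is peeled off, the new covariances are exactly those of the pairs
    [k < j]. *)
Lemma newman (R : realFieldType) (disp : Order.disp_t) (I : finOrderType disp)
    (q : {ffun I -> bool} -> R) (c : R) (s : seq I) :
  (forall b, 0 <= q b) -> \sum_b q b = 1 -> associated_law q ->
  0 <= c <= 1 -> sorted <%O s ->
  mean q (fun b => \prod_(i <- s) (1 - c * (b i)%:R)) <=
  \prod_(i <- s) (1 - c * mean q (fun b => (b i)%:R)) +
  c ^+ 2 * \sum_(i <- s) \sum_(j <- s | (i < j)%O)
             cov q (fun b => (b i)%:R) (fun b => (b j)%:R).
Proof.
move=> q0 q1 qA c01; have /andP[c0 c1] := c01.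
pose x i (b : {ffun I -> bool}) : R := (b i)%:R.
have xmono i (b b' : {ffun I -> bool}) : (forall i, b i -> b' i) -> x i b <= x i b'.
  by move=> bb'; rewrite ler_nat /x; case: (b i) (bb' i) => // ->.
have xle1 i b : x i b <= 1 by rewrite /x lern1 leq_b1.
have C0 i j : 0 <= cov q (x i) (x j).
  by apply: qA => b b'; apply: xmono.
have m0 i : 0 <= mean q (x i).
  by rewrite -(mean_cst 0 q1); apply: mean_le => // b; exact: ler0n.
have m1 i : mean q (x i) <= 1.
  by rewrite -(mean_cst 1 q1); apply: mean_le.
elim: s => [|k s IH] ks.
  by rewrite !big_nil mulr0 addr0; under eq_fun do rewrite big_nil; rewrite mean_cst.
have kall : all (fun j => (k < j)%O) s by apply: (order_path_min lt_trans).
have {}IH := IH (path_sorted ks).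
rewrite !big_cons ltxx.
rewrite [\sum_(j <- s | (k < j)%O) _](_ : _ = \sum_(j <- s) cov q (x k) (x j));
  last first.
  by rewrite big_seq_cond [RHS]big_seq; apply: eq_bigl => j;
     case: (boolP (j \in s)) => //= /(allP kall).
have -> : \sum_(i <- s) \sum_(j <- k :: s | (i < j)%O) cov q (x i) (x j) =
          \sum_(i <- s) \sum_(j <- s | (i < j)%O) cov q (x i) (x j).
  by apply: eq_big_seq => i /(allP kall) ki; rewrite big_cons lt_gtF.
pose F (b : {ffun I -> bool}) := \prod_(i <- s) (1 - c * x i b).
have -> : mean q (fun b => \prod_(i <- k :: s) (1 - c * (b i)%:R)) =
    mean q F - c * mean q (fun b => F b * x k b).
  rewrite -mulNr -meanZ -meanD; congr mean; apply/funext => b.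
  by rewrite big_cons /F /x; ring.
(* F alone decreases; adding c times the sum makes it increase. *)
have : 0 <= cov q (fun b => c * (\sum_(j <- s) x j b) + F b) (x k).
  apply: qA => [b b' bb'|b b']; last exact: xmono.
  rewrite -subr_ge0.
  have := prod_lipschitz s c01 (fun i => ler0n R (b i))
    (fun i => xmono i _ _ bb') (fun i => xle1 i b').
  rewrite -/(F b) -/(F b') sumrB -/(x _ _).
  by rewrite /x; lra.
rewrite covDl cov_suml.
have -> : \sum_(j <- s) cov q (x j) (x k) = \sum_(j <- s) cov q (x k) (x j).
  by apply: eq_bigr => j _; rewrite covC.
set K := \sum_(j <- s) cov q (x k) (x j).
set S := \sum_(i <- s) _ in IH *; rewrite -/K -/S.
have S0 : 0 <= S.
  by apply: sumr_ge0 => i _; apply: sumr_ge0 => j _; exact: C0.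
rewrite -/(mean q (x k)).
set Pr := \prod_(i <- s) _ in IH *; rewrite -/Pr.
rewrite {1}/cov; move: IH; rewrite -/(mean q F).
move: (mean q F) (mean q (fun b => F b * x k b)) => mF mFk IH FK.
have := m0 k; have := m1 k; move: (mean q (x k)) FK => m FK mle mge.
have a01 : 0 <= 1 - c * m <= 1 by apply/andP; split; nra.
have /andP[a0 a1] := a01.
have h1 := ler_wpM2l a0 IH; have h2 := ler_wpM2l c0 FK.
have h3 : 0 <= c * m * (c ^+ 2 * S) by rewrite !mulr_ge0// sqr_ge0.
rewrite !expr2 in h1 h3 *; lra.
Qed.

(** The configuration without success has value one under
    [\prod_i (1 - c * (b i)%:R)], which is nonnegative elsewhere, so its
    weight is at most the mean of that product. *)
Lemma prob_none_le (R : realType) (disp : Order.disp_t)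
    (I : finOrderType disp) (q : {ffun I -> bool} -> R) (t : R) :
  (forall b, 0 <= q b) -> \sum_b q b = 1 -> associated_law q -> 0 < t ->
  q [ffun=> false] <=
  \prod_(i : I) (1 - (1 - expR (- t)) * mean q (fun b => (b i)%:R)) +
  t ^+ 2 * \sum_(i : I) \sum_(j : I | (i < j)%O)
             cov q (fun b => (b i)%:R) (fun b => (b j)%:R).
Proof.
move=> q0 q1 qA t0.
set c := 1 - expR (- t).
have c01 : 0 <= c <= 1.
  by rewrite subr_ge0 gerBl expR_ge0 -expR0 ler_expR oppr_le0 ltW.
have /andP[c0 c1] := c01.
have ct : c <= t by rewrite /c lerBlDr -lerBlDl expR_ge1Dx.
pose s := sort <=%O (enum I).
have ps : perm_eq s (index_enum I).
  by rewrite perm_sort /index_enum -enumT.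
have ss : sorted <%O s by rewrite sort_lt_sorted enum_uniq.
have := newman q0 q1 qA c01 ss.
rewrite (perm_big _ ps) /= [in X in _ + _ * X](perm_big _ ps) /=.
under [X in _ + _ * X]eq_bigr do rewrite (perm_big _ ps) /=.
set S := \sum_i _ => h.
have S0 : 0 <= S.
  apply: sumr_ge0 => i _; apply: sumr_ge0 => j _; apply: qA => b b' bb';
  rewrite ler_nat.
    by case: (b i) (bb' i) => // ->.
  by case: (b j) (bb' j) => // ->.
apply: (@le_trans _ _ (mean q (fun b => \prod_(i <- s) (1 - c * (b i)%:R)))).
  rewrite /mean (bigD1 [ffun=> false]) //= [X in q _ * X]big1 => [|i _].
    rewrite mulr1 lerDl; apply: sumr_ge0 => b _; apply: mulr_ge0 => //.
    apply: prodr_ge0 => i _; rewrite subr_ge0.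
    by case: (b i); rewrite ?mulr1 // mulr0 ler01.
  by rewrite ffunE mulr0 subr0.
apply: (le_trans h); rewrite lerD2l ler_wpM2r // lerXn2r // nnegrE ltW //.
Qed.

(** * The law of the success configuration *)

(** The test is [0 < X i w] rather than [X i w = 1] because a threshold is
    monotone on all of [R], which association of the [X i] requires. *)
Definition success (d : measure_display) (T : measurableType d)
    (R : realType) (P : probability T R) (I : finType) (X : I -> {RV P >-> R})
    (w : T) : {ffun I -> bool} := [ffun i => 0 < X i w].

Definition success_law (d : measure_display) (T : measurableType d)
    (R : realType) (P : probability T R) (I : finType) (X : I -> {RV P >-> R})
    (b : {ffun I -> bool}) : R := fine (P [set w | success X w = b]).

Lemma measurable_success (d : measure_display) (T : measurableType d)
    (R : realType) (P : probability T R) (I : finType) (X : I -> {RV P >-> R})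
    (b : {ffun I -> bool}) :
  measurable [set w | success X w = b].
Proof.
rewrite (_ : mkset _ = \bigcap_(i in setT) (X i @^-1` [set r | (0 < r) = b i])).
  apply: fin_bigcap_measurable => // i _.
  apply: measurable_funPTI => //.
  case: (b i).
    rewrite (_ : mkset _ = `]0, +oo[%classic) //.
    by apply/seteqP; split => r /=; rewrite in_itv /= andbT.
  rewrite (_ : mkset _ = `]-oo, 0]%classic) //.
  by apply/seteqP; split => r /=; rewrite in_itv /= leNgt;
     [move=> ->|move/negbTE].
apply/seteqP; split => w /=.
  by move=> <- i _ /=; rewrite ffunE.
by move=> h; apply/ffunP => i; rewrite ffunE; exact: h.
Qed.

(** [F (success X w)] is the simple function taking the value [F b] on the
    event that the configuration is [b]. *)
Lemma expectation_success (d : measure_display) (T : measurableType d)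
    (R : realType) (P : probability T R) (I : finType) (X : I -> {RV P >-> R})
    (F : {ffun I -> bool} -> R) :
  ('E_P[fun w => F (success X w)] = (mean (success_law X) F)%:E)%E.
Proof.
pose A b := [set w | success X w = b].
have mA b : measurable (A b) by exact: measurable_success.
have A1 b : (\1_(A b) : T -> R) \in Lfun P 1.
  by apply/Lfun1_integrable; apply: integrable_indic.
rewrite (_ : (fun w => F (success X w)) =
  \sum_(Y <- [seq (F b \o* \1_(A b) : T -> R) | b : {ffun I -> bool}]) Y); last first.
  rewrite big_map big_enum; apply/funext => w; rewrite fct_sumE.
  rewrite (bigD1 (success X w)) //= indicE mem_set // mul1r.
  rewrite big1 ?addr0 // => b /eqP bw; rewrite indicE memNset ?mul0r //.
  by move=> /= /esym.
rewrite expectation_sum; last first.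
  by move=> _ /mapP[b _ ->]; apply: Lfun_scale; rewrite ?lexx.
rewrite big_map big_enum /mean -sumEFin; apply: eq_bigr => b _.
rewrite expectationZl // expectation_indic // EFinM muleC fineK //.
apply: fin_num_measure; exact: mA.
Qed.

Lemma sum_success_law (d : measure_display) (T : measurableType d)
    (R : realType) (P : probability T R) (I : finType)
    (X : I -> {RV P >-> R}) :
  \sum_b success_law X b = 1.
Proof.
have := expectation_success X (fun=> 1); rewrite expectation_cst => -[->].
by apply: eq_bigr => b _; rewrite mulr1.
Qed.

Lemma covariance_success (d : measure_display) (T : measurableType d)
    (R : realType) (P : probability T R) (I : finType) (X : I -> {RV P >-> R})
    (F G : {ffun I -> bool} -> R) :
  covariance P (fun w => F (success X w)) (fun w => G (success X w)) =
  (cov (success_law X) F G)%:E.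
Proof.
rewrite covariance.unlock !expectation_success /=.
rewrite (expectation_success X (fun b => (F b - mean (success_law X) F) *
  (G b - mean (success_law X) G))); congr EFin.
set q := success_law X; rewrite /cov.
set mF := mean q F; set mG := mean q G.
have -> : mean q (fun b => (F b - mF) * (G b - mG)) =
    mean q (fun b => F b * G b + ((- mG) * F b + ((- mF) * G b + mF * mG))).
  by apply: eq_bigr => b _; congr (_ * _); ring.
rewrite 3!meanD !meanZ mean_cst ?sum_success_law // -/mF -/mG; ring.
Qed.

(** An increasing function of booleans extends to an increasing function of
    real coordinates through the threshold [0 < x i], which is itself
    increasing. *)
Lemma associated_success (d : measure_display) (T : measurableType d)
    (R : realType) (P : probability T R) (I : finType)
    (X : I -> {RV P >-> R}) :
  positively_associated P (fun i => X i : T -> R) ->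
  associated_law (success_law X).
Proof.
move=> Xassoc F G Fmono Gmono; rewrite -lee_fin -covariance_success.
pose lift (H : {ffun I -> bool} -> R) (x : I -> R) := H [ffun i => 0 < x i].
apply: (Xassoc (lift F) (lift G)) => x y xy; [apply: Fmono|apply: Gmono];
  by move=> i; rewrite !ffunE => /lt_le_trans; apply.
Qed.

(** * The bound for associated indicators *)

Theorem theorem1p7 (d : measure_display) (T : measurableType d) (R : realType)
    (P : probability T R) (disp : Order.disp_t) (I : finOrderType disp)
    (X : I -> {RV P >-> R})
    (X01 : forall i w, X i w = 0 \/ X i w = 1)
    (Xassoc : positively_associated P (fun i => X i : T -> R)) :
  (forall t : R, 0 < t ->
    (P [set w | (\sum_(i : I) X i w)%R = 0%R] <=
     (expR (- (t * #|I|%:R)))%:E *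
     (\prod_(i : I) 'E_P[fun w => expR (t * (1 - X i w))] +
      (t ^+ 2 * expR (t * #|I|%:R))%:E *
      \sum_(i : I) \sum_(j : I | (i < j)%O) covariance P (X i) (X j)))%E) /\
  (forall p : R,
    (forall i : I, P [set w | X i w = 1] = p%:E /\
                   P [set w | X i w = 0] = (1 - p)%:E) ->
    forall t : R, 0 < t ->
    (P [set w | (\sum_(i : I) X i w)%R = 0%R] <=
     (expR (- (t * #|I|%:R)) * (p + (1 - p) * expR t) ^+ #|I|)%:E +
     (t ^+ 2)%:E *
      \sum_(i : I) \sum_(j : I | (i < j)%O) covariance P (X i) (X j))%E /\
    (p < 1 ->
     ((expR (- (t * #|I|%:R)) * (p + (1 - p) * expR t) ^+ #|I|)%:E +
      (t ^+ 2)%:E *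
       \sum_(i : I) \sum_(j : I | (i < j)%O) covariance P (X i) (X j) =
      ((1 - p) ^+ #|I| * (1 + expR (- t) * (p / (1 - p))) ^+ #|I|)%:E +
      (t ^+ 2)%:E *
       \sum_(i : I) \sum_(j : I | (i < j)%O) covariance P (X i) (X j))%E)).
Proof.
pose q := success_law X.
pose m i := mean q (fun b => (b i)%:R).
pose S := \sum_(i : I) \sum_(j : I | (i < j)%O)
  cov q (fun b => (b i)%:R) (fun b => (b j)%:R).
have XE i : (X i : T -> R) = fun w => (success X w i)%:R.
  by apply/funext => w; rewrite ffunE; case: (X01 i w) => ->;
     rewrite ?ltxx ?ltr01.
have covE i j : covariance P (X i) (X j) =
    (cov q (fun b => (b i)%:R) (fun b => (b j)%:R))%:E.
  by rewrite !XE; exact: (covariance_success X).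
have SE : (\sum_(i : I) \sum_(j : I | (i < j)%O) covariance P (X i) (X j) =
           S%:E)%E.
  rewrite /S -sumEFin; apply: eq_bigr => i _; rewrite -sumEFin.
  by apply: eq_bigr => j _.
have P0 : P [set w | \sum_(i : I) X i w = 0] = (q [ffun=> false])%:E.
  rewrite fineK ?fin_num_measure //; last exact: measurable_success.
  congr (P _); apply/seteqP; split => w /=.
    move=> /eqP; rewrite psumr_eq0 => [/allP Xw|i _]; last first.
      by rewrite XE ler0n.
    apply/ffunP => i; rewrite !ffunE.
    by have /eqP -> := Xw i (mem_index_enum i); rewrite ltxx.
  by move=> Xw; rewrite big1 // => i _; rewrite XE Xw ffunE.
have bound t : 0 < t ->
    q [ffun=> false] <= \prod_i (1 - (1 - expR (- t)) * m i) + t ^+ 2 * S.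
  apply: prob_none_le; last exact: associated_success.
    by move=> b; exact: fine_ge0.
  exact: sum_success_law.
have ee (t : R) : expR (- t) * expR t = 1 by rewrite -expRD addNr expR0.
split=> [t t0|p pX t t0].
  rewrite P0 SE.
  have EX i : 'E_P[fun w => expR (t * (1 - X i w))]%E =
      (expR t * (1 - (1 - expR (- t)) * m i))%:E.
    rewrite XE (expectation_success X (fun b => expR (t * (1 - (b i)%:R)))).
    rewrite /m mulrBr mulr1 mulrA; congr EFin.
    rewrite -[X in X - _](mean_cst _ (sum_success_law X)) -mulNr -meanZ -meanD.
    congr mean; apply/funext => b.
    case: (b i); last by rewrite subr0 mulr1 mulr0 addr0.
    rewrite subrr mulr0 expR0 mulr1 mulrBr mulr1 [expR t * _]mulrC ee; ring.
  under eq_bigr do rewrite EX.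
  rewrite prodEFin -EFinM lee_fin big_split /= prodr_const.
  rewrite expRM_natr -mulNr expRM_natr.
  have een : expR (- t) ^+ #|I| * expR t ^+ #|I| = 1.
    by rewrite -exprMn ee expr1n.
  (* Both terms carry the factor exp (t |I|), cancelled by exp (- t |I|). *)
  set a := \prod_i _.
  have -> : expR (- t) ^+ #|I| * (expR t ^+ #|I| * a +
      t ^+ 2 * expR t ^+ #|I| * S) =
    expR (- t) ^+ #|I| * expR t ^+ #|I| * (a + t ^+ 2 * S) by ring.
  by rewrite een mul1r; exact: bound.
have mp i : m i = p.
  apply: EFin_inj; rewrite -(expectation_success X (fun b => (b i)%:R)).
  have [<- _] := pX i.
  have mX : measurable [set w | X i w = 1].
    by rewrite (_ : mkset _ = X i @^-1` [set 1]) //; apply: measurable_funPTI.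
  rewrite -expectation_indic //; congr expectation.
  apply/funext => w; rewrite indicE /= ffunE.
  case: (X01 i w) => Xw.
    by rewrite Xw ltxx memNset //= Xw => /esym/eqP; rewrite oner_eq0.
  by rewrite Xw ltr01 mem_set.
rewrite P0 SE.
have fE : expR (- (t * #|I|%:R)) * (p + (1 - p) * expR t) ^+ #|I| =
    (1 - (1 - expR (- t)) * p) ^+ #|I|.
  rewrite -mulNr expRM_natr -exprMn; congr (_ ^+ _).
  by rewrite mulrDr [expR (- t) * (_ * _)]mulrCA ee; ring.
rewrite fE; split.
  rewrite -EFinM -EFinD lee_fin; apply: (le_trans (bound t t0)).
  by under eq_bigr do rewrite mp; rewrite prodr_const.
move=> p1; rewrite -exprMn.
have -> // : 1 - (1 - expR (- t)) * p =
  (1 - p) * (1 + expR (- t) * (p / (1 - p))).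
by field; rewrite subr_eq0 gt_eqF.
Qed.
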